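(* Suppose that \[\lim_{k\to\infty}\lim_{N\to\infty}\frac{\log F'_k(N)}{\log N}=1.\] Then for every positive integer $n$, every set $B\subset\mathbb{R}^n$ that contains a unit line segment in every direction satisfies $\dim_P B=n$.
   Context: For positive integers $k,N$, $F'_k(N)$ denotes the size of the smallest set of integers that contains a $k$-term arithmetic progression $\{a,a+d,\dots,a+(k-1)d\}$ with common difference $d$, for $N$ distinct integer values of $d$. The hypothesis is (one formulation of) the arithmetic Kakeya conjecture of Katz and Tao. $\dim_P$ denotes packing dimension. *)

(* Defs.v *)
From HB Require Import structures.
From mathcomp Require Import all_boot all_order all_algebra finmap.
From mathcomp Require Import all_classical all_reals all_analysis.

Set Implicit Arguments.
Unset Strict Implicit.
Unset Printing Implicit Defensive.

Import Order.TTheory GRing.Theory Num.Theory.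
Import numFieldNormedType.Exports.

Local Open Scope classical_set_scope.
Local Open Scope ring_scope.

Definition contains_AP (k : nat) (d : int) (A : {fset int}) : Prop :=
  exists a : int, forall j : nat, (j < k)%N -> a + d *+ j \in A.

Definition AP_rich (k N : nat) (A : {fset int}) : Prop :=
  exists D : {fset int},
    #|` D|%fset = N /\ forall d : int, d \in D -> contains_AP k d A.

Definition AP_rich_size (k N : nat) : pred nat :=
  fun m => `[< exists A : {fset int}, #|` A|%fset = m /\ AP_rich k N A >].

Lemma AP_rich_size_ex (k N : nat) : exists m, AP_rich_size k N m.
Proof.
pose D := seq_fset tt [seq Posz i | i <- iota 0 N].
pose A := seq_fset tt [seq d *+ j | d <- enum_fset D, j <- iota 0 k].
exists #|` A|%fset; apply/asboolP; exists A; split=> //; exists D; split.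
  rewrite size_seq_fset undup_id ?size_map ?size_iota //.
  by rewrite map_inj_uniq ?iota_uniq // => i j [].
move=> d dD; exists 0 => j jk; rewrite add0r seq_fsetE.
by apply: allpairs_f => //; rewrite mem_iota.
Qed.

(* F'_k(N) *)
Definition AP_min (k N : nat) : nat := ex_minn (AP_rich_size_ex k N).

Section Euclidean.
Variables (R : realType) (n : nat).
Implicit Types (E : set 'rV[R]_n) (s delta : R).

(* The library norm on 'rV[R]_n is the sup norm. *)
Definition enorm (x : 'rV[R]_n) : R := Num.sqrt (\sum_(i < n) x 0 i ^+ 2).

Definition eball (x : 'rV[R]_n) (r : R) : set 'rV[R]_n :=
  [set y | enorm (y - x) <= r].

Definition unit_segment_every_direction E : Prop :=
  forall e : 'rV[R]_n, enorm e = 1 ->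
    exists a : 'rV[R]_n, forall t : R, 0 <= t <= 1 -> E (a + t *: e).

(* A finite or countable family of balls is indexed by a subset I of nat. *)
Definition is_packing E delta (I : set nat) (x : nat -> 'rV[R]_n)
    (r : nat -> R) : Prop :=
  (forall i, I i -> E (x i) /\ 0 < r i <= delta) /\
  trivIset I (fun i => eball (x i) (r i)).

(* The term is the s-th power of the diameter 2 * r i of the i-th ball. *)
Definition packing_content s delta E : \bar R :=
  ereal_sup [set v | exists I x r, is_packing E delta I x r /\
                     v = (\esum_(i in I) ((2 * r i) `^ s)%:E)%E].

(* [packing_content s delta E] is nondecreasing in delta, so the infimum over
   delta > 0 is the limit as delta tends to 0. *)
Definition packing_premeasure s E : \bar R :=
  ereal_inf [set packing_content s delta E | delta in [set delta | 0 < delta]].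

Definition packing_measure s E : \bar R :=
  ereal_inf [set v | exists F : nat -> set 'rV[R]_n,
    E `<=` \bigcup_i F i /\
    v = (\sum_(0 <= i <oo) packing_premeasure s (F i))%E].

Definition packing_dim E : \bar R :=
  ereal_inf [set s%:E | s in [set s | 0 <= s /\ packing_measure s E = 0%E]].

End Euclidean.

(* Main.v *)
Require Import Defs.
From HB Require Import structures.
From mathcomp Require Import all_boot all_order all_algebra finmap.
From mathcomp Require Import all_classical all_reals all_analysis.
From mathcomp Require Import ring lra zify.

(** A countable cover of B witnessing that the s-dimensional packing measure
    vanishes consists of sets F_i that contain at most O(d^-s) disjoint balls of
    radius d.  Baire's theorem, applied first to the points of each segment and
    then to the directions, yields one F_i whose closure contains, for a dense
    set of directions (v, 1) with v in some ball, a segment over a fixed interval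
    [p, q] of heights.  Rounding to the lattice d Z^n, the slices of F_i at heights
    d (a + j h), j < k, contain k-term progressions with about d^-(n-1) different
    common differences, so they have at least d^-(n-1)(1-eps) points by the
    arithmetic Kakeya hypothesis.  The h ~ 1/d possible residues of the height
    mod h give disjoint families of slices, so F_i has at least d^-(n - n eps)
    lattice points nearby, which forces s >= n.

    Conversely, for s > n, grouping the balls of a packing of a box by the dyadic
    size of their radii bounds the packing sum by a geometric tail. *)

Set Implicit Arguments.
Unset Strict Implicit.
Unset Printing Implicit Defensive.

Import Order.TTheory GRing.Theory Num.Theory.
Import numFieldNormedType.Exports.

Local Open Scope classical_set_scope.
Local Open Scope ring_scope.

(** * Progressions in lattices *)

Lemma AP_min_le (k N : nat) (A : {fset int}) :
  AP_rich k N A -> (AP_min k N <= #|` A|%fset)%N.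
Proof.
move=> rA; rewrite /AP_min; case: ex_minnP => m _; apply.
by apply/asboolP; exists A.
Qed.

Lemma AP_min_gt0 (k N : nat) : (0 < k)%N -> (0 < N)%N -> (0 < AP_min k N)%N.
Proof.
move=> k0 N0; rewrite /AP_min; case: ex_minnP => m /asboolP[A [<- [D [DN AD]]]] _.
have /fset0Pn[d dD] : D != fset0 by rewrite -cardfs_gt0 DN.
have [a /(_ 0 k0)] := AD d dD.
by rewrite mulr0n addr0 cardfs_gt0 => aA; apply/fset0Pn; exists a.
Qed.

(* Each nonzero difference of two vectors in the list gives a nonzero polynomial;
   any integer that is a root of none of them will do. *)
Lemma exists_injective_functional (m : nat) (s : seq 'rV[int]_m) :
  exists f : {additive 'rV[int]_m -> int}, {in s &, injective f}.
Proof.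
pose P := \prod_(d <- [seq x - y | x <- s, y <- s] | d != 0) rVpoly d.
have P0 : P != 0.
  rewrite /P prodf_seq_neq0; apply/allP => d _ /=; apply/implyP => d0.
  by apply: contra_neq d0 => e; rewrite -[d]rVpolyK e linear0.
(* A nonzero polynomial has fewer roots than its size, so the integers below [size P] cannot all be
   roots. *)
have [M rM] : exists M : int, ~~ root P M.
  apply: contrapT => /forallNP allroot.
  have := @max_poly_roots _ P [seq Posz i | i <- iota 0 (size P)] P0.
  rewrite size_map size_iota ltnn => /(_ _ _)/negP; apply => //.
    by apply/allP => x _; move: (allroot x) => /negP; rewrite negbK.
  by rewrite map_inj_uniq ?iota_uniq // => i j [].
exists (horner_eval M \o rVpoly) => x y xs ys /= xy.
apply/eqP; rewrite -subr_eq0; apply: contraT => d0.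
have xyD : x - y \in [seq x - y | x <- s, y <- s] by apply: allpairs_f.
move: rM; rewrite /P rootE horner_prod.
rewrite prodf_seq_neq0 => /allP /(_ _ xyD) /=; rewrite d0 /=.
by rewrite linearB /= hornerD hornerN -!/(horner_eval M _) xy subrr eqxx.
Qed.

(** A functional injective on [D] carries the progressions into the integers without merging
    differences; merging points of [T] only lowers the count. *)
Lemma AP_min_le_vector (m k : nat) (T D : {fset 'rV[int]_m}) :
  (forall d, d \in D -> exists a, forall j, (j < k)%N -> a + d *+ j \in T) ->
  (AP_min k #|` D|%fset <= #|` T|%fset)%N.
Proof.
move=> DT; have [f injf] := exists_injective_functional (enum_fset D).
apply: (@leq_trans #|` [fset f x | x in T]%fset|%fset); last exact: leq_imfset_card.
apply: AP_min_le; exists [fset f x | x in D]%fset; split.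
  by rewrite card_in_imfset.
move=> _ /imfsetP[d /= dD ->]; have [a aT] := DT d dD.
exists (f a) => j jk; apply/imfsetP; exists (a + d *+ j) => /=; first exact: aT.
by rewrite raddfD raddfMn.
Qed.

Lemma card_fset_fibers (K : choiceType) (C : finType) (f : K -> C) (T : {fset K}) :
  #|` T|%fset = (\sum_(c : C) #|` [fset z in T | f z == c]%fset|%fset)%N.
Proof.
rewrite [RHS](eq_bigr (fun c => \sum_(z <- enum_fset T) (f z == c : nat)))%N; last first.
  move=> c _; rewrite card_fset_sum1 big_fset /= big_mkcond /=.
  by apply: eq_bigr => z _; case: (f z == c).
rewrite exchange_big /= card_fset_sum1; apply: eq_bigr => z _.
by rewrite (bigD1 (f z)) //= eqxx big1 ?addn0 // => c; rewrite eq_sym => /negPf ->.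
Qed.

(* The progressions with a given starting height live in one residue class of
   heights mod h, and distinct residue classes are disjoint. *)
Lemma AP_min_mul_le (m k h : nat) (l : 'I_m) (b : int) (T D : {fset 'rV[int]_m}) :
  (forall d, d \in D -> d 0 l = h%:Z) ->
  (forall d (i : 'I_h), d \in D ->
     exists a : 'rV[int]_m, a 0 l = b + (i : nat)%:Z /\
       forall j, (j < k)%N -> a + d *+ j \in T) ->
  (h * AP_min k #|` D|%fset <= #|` T|%fset)%N.
Proof.
case: h => // h Dh DT.
pose f (z : 'rV[int]_m) : 'I_h.+1 := inord `|((z 0%R l - b) %% h.+1%:Z)%Z|%N.
rewrite (card_fset_fibers f T) -[X in (X * _)%N]card_ord -sum_nat_const.
apply: leq_sum => i _.
apply: AP_min_le_vector => d dD; have [a [al aT]] := DT d i dD.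
exists a => j jk; rewrite !inE aT //= /f !mxE al mulmxnE Dh //.
have -> : b + i%:Z + h.+1%:Z *+ j - b = i%:Z + j%:Z * h.+1%:Z.
  by rewrite -mulr_natl natz; ring.
rewrite addrC modzMDl modz_small ?lez_nat ?ltz_nat ?ltn_ord //=.
by rewrite inord_val.
Qed.

(** * The Euclidean norm *)

Section Enorm.
Variables (R : realType) (m : nat).
Implicit Types y : 'rV[R]_m.

Lemma enorm0 : enorm (0 : 'rV[R]_m) = 0.
Proof. by rewrite /enorm big1 ?sqrtr0 // => i _; rewrite mxE expr0n. Qed.

Lemma enorm_gt0 y i : y 0 i != 0 -> 0 < enorm y.
Proof.
move=> yi; rewrite /enorm sqrtr_gt0 (bigD1 i) //=.
by rewrite ltr_pwDl ?exprn_even_gt0 // sumr_ge0 // => j _; rewrite sqr_ge0.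
Qed.

Lemma enormZ (c : R) y : 0 <= c -> enorm (c *: y) = c * enorm y.
Proof.
move=> c0; rewrite /enorm -{2}(ger0_norm c0) -sqrtr_sqr -sqrtrM ?sqr_ge0 //.
by congr Num.sqrt; rewrite mulr_sumr; apply: eq_bigr => i _; rewrite mxE exprMn.
Qed.

Lemma enorm_le_sum y : enorm y <= \sum_(i < m) `|y 0 i|.
Proof.
have s0 : 0 <= \sum_(i < m) `|y 0 i| by exact: sumr_ge0.
rewrite -(ger0_norm s0) -sqrtr_sqr /enorm ler_sqrt ?sqr_ge0 //.
rewrite expr2 mulr_suml; apply: ler_sum => i _.
rewrite -real_normK ?num_real // expr2 ler_wpM2l //.
by rewrite (bigD1 i) //= lerDl sumr_ge0.
Qed.

Lemma ler_norm_enorm y i : `|y 0 i| <= enorm y.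
Proof.
rewrite -sqrtr_sqr /enorm ler_sqrt; last by apply: sumr_ge0 => j _; exact: sqr_ge0.
by rewrite (bigD1 i) //= lerDl sumr_ge0 // => j _; exact: sqr_ge0.
Qed.

End Enorm.

(** * Lines in the closure of a covering set *)

(** Lets Baire's theorem be applied to row vectors as a complete normed space. *)
HB.instance Definition _ (R : realType) (m n : nat) := Complete.on 'M[R]_(m, n).

(** Otherwise the complements of these closures are open and dense, and some point of [U] lies in
    all of them, hence in no [S i]. *)
Lemma Baire_cover (R : realType) (V : completeNormedModType R) (U : set V)
    (S : nat -> set V) :
  open U -> U !=set0 -> U `<=` \bigcup_i S i ->
  exists i (W : set V), [/\ open W, W !=set0 & W `<=` closure (S i `&` U)].
Proof.
move=> oU U0 US; apply: contrapT => /forallNP nS.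
have : dense (\bigcap_i ~` closure (S i `&` U)).
  apply: Baire => i; split; first exact/closed_openC/closed_closure.
  move=> W W0 oW; apply: contrapT => WS; apply: (nS i); exists W; split=> //.
  by move=> x Wx; apply: contrapT => Sx; apply: WS; exists x.
move=> /(_ U U0 oU) [x [Ux Sx]]; have [i _ Six] := US x Ux.
by apply: (Sx i) => //; apply: subset_closure.
Qed.

Section Directions.
Variables (R : realType) (n : nat).
Implicit Types (F B : set 'rV[R]_n.+1) (v x : 'rV[R]_n.+1).

(* The last entry of [v] is ignored, so that all directions transversal to the
   horizontal hyperplane are parametrised by the full space ['rV_n.+1]. *)
Definition dir v : 'rV[R]_n.+1 :=
  \row_i (if i == ord_max then 1 else v 0 i).

(** The closure appears because Baire's theorem gives only density along the line. As [x] and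
    [dir v] have last coordinates 0 and 1, [t] is the height. *)
Definition contains_line_between F (p q : R) v : Prop :=
  exists x, x 0 ord_max = 0 /\ forall t, p <= t <= q -> closure F (x + t *: dir v).

Lemma closure_line F (G : set R) x v t :
  (forall u, G u -> F (x + u *: v)) -> closure G t -> closure F (x + t *: v).
Proof.
move=> GF Gt A nA.
have cf : (fun u : R => x + u *: v) @ t --> x + t *: v.
  by apply: cvgD; [exact: cvg_cst | apply: cvgZl; exact: cvg_id].
by have [u [Gu Au]] := Gt _ (cf _ nA); exists (x + u *: v); split; [exact: GF|].
Qed.

(** Rational endpoints leave only countably many intervals for the second use of Baire's theorem, in
    [dense_directions]. *)
Lemma open_contains_rat_interval (W : set R) : open W -> W !=set0 ->
  exists p q : rat, (p < q) /\ forall t : R, ratr p <= t <= ratr q -> W t.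
Proof.
move=> oW [x Wx]; have /nbhs_ballP[e /= e0 eW] : nbhs x W by exact: open_nbhs_nbhs.
have [p] := @rat_in_itvoo R (x - e) x ltac:(lra).
have [q] := @rat_in_itvoo R x (x + e) ltac:(lra).
rewrite !in_itv /= => /andP[q1 q2] /andP[p1 p2].
exists p, q; split; first by rewrite -(ltr_rat R); lra.
move=> t /andP[t1 t2]; apply: eW.
by rewrite /ball /= ltr_distlC; lra.
Qed.

Lemma unit_segment_contains_line B (F : nat -> set 'rV[R]_n.+1) v :
  unit_segment_every_direction B -> B `<=` \bigcup_i F i ->
  exists i (p q : rat), p < q /\ contains_line_between (F i) (ratr p) (ratr q) v.
Proof.
move=> useg BF; pose w := dir v.
have w0 : 0 < enorm w by apply: (@enorm_gt0 _ _ _ ord_max); rewrite mxE eqxx oner_eq0.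
have [|a aB] := useg ((enorm w)^-1 *: w).
  by rewrite enormZ ?invr_ge0 ?ltW // mulVf // gt_eqF.
(* [c] is the height where the segment starts and [x] the point of its line at height 0; the segment
   spans heights from [c] to [c + (enorm w)^-1]. *)
pose c := a 0 ord_max; pose x := a - c *: w.
pose U : set R := [set` `]c, c + (enorm w)^-1[].
have [||t|i [W [oW W0 WS]]] := @Baire_cover R R U (fun i t => F i (x + t *: w)).
- exact: interval_open.
- exists (c + (enorm w)^-1 / 2); have := w0; rewrite -invr_gt0 /U /= in_itv /=; lra.
- rewrite /U /= in_itv /= => /andP[t1 t2]; apply: BF.
  have -> : x + t *: w = a + ((t - c) * enorm w) *: ((enorm w)^-1 *: w).
    by rewrite scalerA mulfK ?gt_eqF // /x scalerBl addrAC addrA.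
  apply: aB; rewrite mulr_ge0 ?(ltW w0) ?subr_ge0 ?(ltW t1) //=.
  by rewrite -ler_pdivlMr // div1r; lra.
have [p [q [pq pqW]]] := open_contains_rat_interval oW W0.
exists i, p, q; split=> //; exists x; split.
  by rewrite /x !mxE eqxx mulr1 subrr.
move=> t /pqW /WS; apply: closure_line => u [] //.
Qed.

Lemma dense_directions B (F : nat -> set 'rV[R]_n.+1) :
  unit_segment_every_direction B -> B `<=` \bigcup_i F i ->
  exists i (p q : R) (v0 : 'rV[R]_n.+1) (e : R), [/\ p < q, 0 < e &
    ball v0 e `<=` closure (contains_line_between (F i) p q)].
Proof.
move=> useg BF.
(* Triples of an index and two rational endpoints are coded by natural numbers, so [S] is a
   sequence. *)
pose S (m : nat) : set 'rV[R]_n.+1 := if choice.unpickle m is Some (i, p, q) then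
  [set v | (p < q :> rat) /\ contains_line_between (F i) (ratr p) (ratr q) v] else set0.
have [||v _|m [W [oW [v0 Wv0]]]] :=
  @Baire_cover R ('rV[R]_n.+1 : completeNormedModType R) setT S.
- exact: openT.
- by exists 0.
- have [i [p [q pqv]]] := unit_segment_contains_line v useg BF.
  by exists (choice.pickle (i, p, q)) => //; rewrite /S choice.pickleK.
rewrite setIT /S; case: choice.unpickle => [[[i p] q]|]; last first.
  by rewrite closure0 => /(_ _ Wv0).
move=> WS; have /nbhs_ballP[e /= e0 eW] : nbhs v0 W by exact: open_nbhs_nbhs.
(* [p < q] does not depend on the direction, so any member of the set adherent to [v0] supplies
   it. *)
have [v [[pq _] _]] := WS _ Wv0 _ filterT.
exists i, (ratr p), (ratr q), v0, e; split=> //; first by rewrite ltr_rat.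
by move=> y /eW /WS; apply: closure_subset => z [].
Qed.

End Directions.

(** * Packing dimension is at most the ambient dimension *)

Section UpperBound.
Variables (R : realType) (m : nat).
Implicit Types (E : set 'rV[R]_m) (s : R).

(** Pigeonhole on a grid of mesh [1 / (m * 2 ^ l)]: two centres in one cell are within [2^-1 ^+ l]
    in the sum norm, so their balls meet. *)
Lemma disjoint_ball_count (M l : nat) (J : seq nat) (x : nat -> 'rV[R]_m)
    (r : nat -> R) :
  uniq J -> (forall j, j \in J -> forall i, `|x j 0 i| <= M%:R) ->
  (forall j, j \in J -> 2^-1 ^+ l <= r j) ->
  trivIset [set` J] (fun j => eball (x j) (r j)) ->
  (size J <= ((2 * M * m).+1 * 2 ^ l) ^ m)%N.
Proof.
move=> uJ xM rl tJ.
pose K := ((2 * M * m).+1 * 2 ^ l)%N.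
have K0 : (0 < K)%N by rewrite muln_gt0 /= expn_gt0.
pose g j i : R := (x j 0 i + M%:R) * (m * 2 ^ l)%:R.
pose f j : {ffun 'I_m -> 'I_K.-1.+1} := [ffun i => inord (Num.truncn (g j i))].
have g0 j i : j \in J -> 0 <= g j i.
  by move=> /xM/(_ i); rewrite ler_norml => /andP[h _]; rewrite mulr_ge0 //; lra.
have gK j i : j \in J -> (Num.truncn (g j i) < K.-1.+1)%N.
  move=> jJ; rewrite prednK // truncn_lt_nat ?g0 //.
  apply: (@le_lt_trans _ _ ((2 * M * m) * 2 ^ l)%N%:R); last first.
    by rewrite ltr_nat ltn_mul2r expn_gt0 /= ltnS.
  rewrite -mulnA natrM ler_wpM2r // natrM.
  by have := xM j jJ i; rewrite ler_norml => /andP[_ h]; lra.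
have injf : {in J &, injective f}.
  move=> j j' jJ jJ' fjj'.
  apply: (tJ j j') => //; exists (x j); split; rewrite /eball /=.
    by rewrite subrr enorm0 (le_trans _ (rl j jJ)).
  apply: le_trans (rl j' jJ'); apply: le_trans (enorm_le_sum _) _.
  apply: (@le_trans _ _ (\sum_(i < m) (2^-1 ^+ l / m%:R))).
    apply: ler_sum => i _; rewrite !mxE.
    have m0 : 0 < (m%:R : R) by rewrite ltr0n (leq_ltn_trans _ (ltn_ord i)).
    have p0 : 0 < (2 ^ l)%:R :> R by rewrite ltr0n expn_gt0.
    have : Num.truncn (g j i) = Num.truncn (g j' i).
      have : val (f j i) = val (f j' i) by rewrite fjj'.
      by rewrite !ffunE /= !inordK ?gK.
    have /truncn_itv/andP[a1 a2] := g0 j i jJ.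
    have /truncn_itv/andP[b1 b2] := g0 j' i jJ'.
    move=> e; rewrite e in a1 a2.
    have : `|g j i - g j' i| <= 1.
      by rewrite ler_distl; move: a2 b2; rewrite -!natr1; lra.
    have -> : g j i - g j' i = (x j 0 i - x j' 0 i) * (m * 2 ^ l)%:R.
      by rewrite /g; ring.
    rewrite normrM (ger0_norm (ler0n _ _)) natrM mulrA => h.
    by rewrite ler_pdivlMr // exprVn -natrX -[leRHS]div1r ler_pdivlMr.
  rewrite sumr_const card_ord; case: (posnP m) => [->|m0].
    by rewrite mulr0n exprn_ge0.
  by rewrite -[leLHS]mulr_natr divfK // pnatr_eq0 -lt0n.
rewrite -(size_map f) -(card_uniqP _); last by rewrite map_inj_in_uniq.
by apply: (leq_trans (max_card _)); rewrite card_ffun !card_ord prednK.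
Qed.

(** The least admissible [l] works: the power one level lower exceeds [r], unless [l = l0], where
    the hypothesis bounds [r]. *)
Lemma dyadic_level (l0 : nat) (r : R) : 0 < r <= 2^-1 ^+ l0 ->
  exists l, [/\ (l0 <= l)%N, 2^-1 ^+ l <= r & r <= 2 * 2^-1 ^+ l].
Proof.
move=> /andP[r0 rl0].
have [|l /andP[l0l lr] lmin] := @ex_minnP (fun l => (l0 <= l)%N && (2^-1 ^+ l <= r)).
  have c : (fun l => 2^-1 ^+ l : R) @ \oo --> (0 : R).
    by apply: cvg_expr; rewrite ger0_norm //; lra.
  have /cvgrPdist_le/(_ r r0)[N _ HN] := c.
  exists (maxn N l0); rewrite leq_maxr /=; have := HN (maxn N l0) (leq_maxl _ _).
  by rewrite /= sub0r normrN ger0_norm // exprn_ge0.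
exists l; split=> //; move: l0l; rewrite leq_eqVlt => /predU1P[<-|l0l].
  have : 0 <= (2^-1 : R) ^+ l0 by rewrite exprn_ge0.
  lra.
case: l l0l lr lmin => // l l0l lr lmin.
rewrite exprS mulrA mulfV // mul1r leNgt; apply/negP => rl.
by have := lmin l; rewrite -ltnS l0l (ltW rl) ltnn => /(_ isT).
Qed.

Definition box (M : nat) : set 'rV[R]_m := [set y | forall i, `|y 0 i| <= M%:R].

(** Level [l] holds at most [((2 * M * m).+1 * 2 ^ l) ^ m] balls of diameter at most
    [4 * 2^-1 ^+ l], so it contributes at most a constant times [q ^+ l]. *)
Lemma box_packing_sum (M l0 : nat) s (J : seq nat) (x : nat -> 'rV[R]_m)
    (r : nat -> R) (q := 2 ^+ m * 2^-1 `^ s) : 0 <= s -> q < 1 ->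
  uniq J -> (forall j, j \in J -> box M (x j) /\ 0 < r j <= 2^-1 ^+ l0) ->
  trivIset [set` J] (fun j => eball (x j) (r j)) ->
  \sum_(j <- J) (2 * r j) `^ s <=
    ((2 * M * m).+1 ^ m)%:R * 4 `^ s * (q ^+ l0 / (1 - q)).
Proof.
move=> s0 q1 uJ xr tJ; have q0 : 0 <= q by rewrite mulr_ge0 ?powR_ge0 ?exprn_ge0.
pose A := ((2 * M * m).+1 ^ m)%:R * 4 `^ s.
have /choice[lev levP] j : exists l, j \in J ->
    [/\ (l0 <= l)%N, 2^-1 ^+ l <= r j & r j <= 2 * 2^-1 ^+ l].
  case: (boolP (j \in J)) => [jJ|_]; last by exists 0.
  by have [_ /dyadic_level[l]] := xr j jJ; exists l.
pose L := \max_(j <- J) lev j.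
pose p j : 'I_L.+1 := inord (lev j).
have pE j : j \in J -> p j = lev j :> nat.
  by move=> jJ; rewrite inordK // ltnS /L leq_bigmax_seq.
have half0 : 0 <= (2^-1 : R) by lra.
rewrite (partition_big p predT) //=.
apply: (@le_trans _ _ (\sum_(l < L.+1 | (l0 <= l)%N) A * q ^+ l)).
  rewrite [leRHS]big_mkcond /=; apply: ler_sum => l _.
  case: (leqP l0 l) => [l0l|ll0]; last first.
    rewrite big1_seq // => j /andP[/eqP pj jJ].
    have [h _ _] := levP j jJ; move: ll0.
    by rewrite -pj pE // ltnNge h.
  rewrite -big_filter; set Jl := [seq _ <- _ | _].
  have JlP j : j \in Jl -> j \in J /\ lev j = l.
    by rewrite mem_filter => /andP[/eqP pj jJ]; rewrite -pE // pj.
  have cJl : (size Jl <= ((2 * M * m).+1 * 2 ^ l) ^ m)%N.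
    apply: (@disjoint_ball_count M l Jl x r).
    - exact: filter_uniq.
    - by move=> j /JlP[/xr[]].
    - by move=> j /JlP[jJ <-]; have [] := levP j jJ.
    - by apply: sub_trivIset tJ => j /= /JlP[].
  apply: (@le_trans _ _ (\sum_(j <- Jl) 4 `^ s * (2^-1 `^ s) ^+ l)).
    rewrite big_seq [leRHS]big_seq; apply: ler_sum => j /JlP[jJ jl].
    have [_ _] := levP j jJ; rewrite jl => rj.
    have [_ /andP[r0 _]] := xr j jJ.
    rewrite -powR_mulrn ?powR_ge0 // powRAC powR_mulrn // -powRM ?exprn_ge0 //.
    by rewrite ge0_ler_powR ?nnegrE ?mulr_ge0 ?exprn_ge0 ?(ltW r0) //; lra.
  rewrite big_const_seq count_predT iter_addr_0 -[leLHS]mulr_natr mulrC /A.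
  rewrite mulrA [X in _ <= X]mulrC /q exprMn.
  have -> : 2 ^+ m ^+ l * 2^-1 `^ s ^+ l * (((2 * M * m).+1 ^ m)%:R * 4 `^ s) =
     ((((2 * M * m).+1 * 2 ^ l) ^ m)%N%:R * 4 `^ s) * (2^-1 `^ s) ^+ l.
    rewrite expnMn natrM -expnM [(l * m)%N]mulnC expnM !natrX; ring.
  rewrite ler_wpM2r ?exprn_ge0 ?powR_ge0 // ler_wpM2r ?powR_ge0 //.
  by rewrite ler_nat.
rewrite -mulr_sumr; apply: ler_wpM2l; first by rewrite mulr_ge0 ?powR_ge0.
rewrite ler_pdivlMr ?subr_gt0 // mulr_suml.
(* Multiplication by [1 - q] telescopes the sum; [maxn] covers the empty range [K <= l0]. *)
have tele (K : nat) : \sum_(l < K | (l0 <= l)%N) q ^+ l * (1 - q) =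
    q ^+ l0 - q ^+ (maxn K l0).
  elim: K => [|K IH]; first by rewrite big_ord0 max0n subrr.
  rewrite big_mkcond big_ord_recr -big_mkcond /= IH.
  case: (leqP l0 K) => [lK|Kl].
    by rewrite (maxn_idPl (leqW lK)) exprS; ring.
  by rewrite addr0 (maxn_idPr Kl).
by rewrite tele lerBlDr lerDl exprn_ge0.
Qed.

Lemma packing_content_ge0 s d E : (0 <= packing_content s d E)%E.
Proof.
apply: ereal_sup_ubound; exists set0, (fun=> 0), (fun=> 1).
split; last by rewrite esum_set0.
by split=> [i []|i j []].
Qed.

Lemma packing_premeasure_ge0 s E : (0 <= packing_premeasure s E)%E.
Proof. by apply: le_ereal_inf_tmp => _ [d _ <-]; exact: packing_content_ge0. Qed.

Lemma packing_premeasure_box (M : nat) s : m%:R < s -> packing_premeasure s (box M) = 0%E.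
Proof.
move=> ms; have s0 : 0 <= s by rewrite (le_trans _ (ltW ms)).
apply/eqP; rewrite eq_le packing_premeasure_ge0 andbT.
pose q : R := 2 ^+ m * 2^-1 `^ s.
have q1 : q < 1.
  rewrite /q -powR_mulrn // -powR_inv1 // -powRrM mulN1r powRN.
  by rewrite ltr_pdivrMr ?powR_gt0 // mul1r /powR gt_eqF //=
    ltr_expR ltr_pM2r // ln_gt0; lra.
pose A : R := ((2 * M * m).+1 ^ m)%:R * 4 `^ s / (1 - q).
apply/lee_addgt0Pr => e e0; rewrite add0e.
have [l0 l0e] : exists l0, A * q ^+ l0 <= e.
  have c : (fun l => A * q ^+ l) @ \oo --> A * 0.
    apply: cvgM; first exact: cvg_cst.
    by apply: cvg_expr; rewrite ger0_norm // mulr_ge0 ?powR_ge0 ?exprn_ge0.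
  move/cvgrPdist_le/(_ e e0) : c => [N _ HN]; exists N.
  have := HN N (leqnn N); rewrite /= mulr0 sub0r normrN.
  by apply: le_trans; exact: ler_norm.
apply: (@le_trans _ _ (packing_content s (2^-1 ^+ l0) (box M))).
  by apply: ereal_inf_lbound; exists (2^-1 ^+ l0) => //=; rewrite exprn_gt0.
apply: ge_ereal_sup => _ [I [x [r [[pk tI] ->]]]].
(* The sum over [I] is the supremum of its finite subsums, so finite packings suffice. *)
apply: ge_ereal_sup => _ [J [fJ JI] <-].
rewrite fsbig_finite //= sumEFin lee_fin; apply: le_trans l0e.
have -> : A * q ^+ l0 = ((2 * M * m).+1 ^ m)%:R * 4 `^ s * (q ^+ l0 / (1 - q)).
  by rewrite /A; ring.
have memJ j : j \in fset_set J -> I j by rewrite in_fset_set // inE => /JI.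
apply: (@box_packing_sum M l0 s _ x) => //.
- exact: fset_uniq.
- by move=> j /memJ/pk.
- by apply: sub_trivIset tI => j /= /memJ.
Qed.

Lemma packing_dim_le E : (packing_dim E <= m%:R%:E)%E.
Proof.
apply/lee_addgt0Pr => e e0; apply: ereal_inf_lbound.
exists (m%:R + e); last by rewrite EFinD.
split; first by rewrite addr_ge0 // ltW.
apply/eqP; rewrite eq_le; apply/andP; split; last first.
  apply: le_ereal_inf_tmp => _ [F [_ ->]]; apply: nneseries_ge0 => i _ _.
  exact: packing_premeasure_ge0.
apply: ereal_inf_lbound; exists box; split.
  move=> y _; exists (Num.truncn (\sum_i `|y 0 i|)).+1 => // i.
  apply: (@le_trans _ _ (\sum_i `|y 0 i|)).
    by rewrite (bigD1 i) //= lerDl sumr_ge0.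
  by apply: ltW; have /truncn_itv/andP[] : 0 <= \sum_i `|y 0 i| by exact: sumr_ge0.
rewrite eseries0 // => i _ _; apply: packing_premeasure_box; lra.
Qed.

End UpperBound.

(** * Discretisation and the lower bound *)

(** Each of the [9 ^ m] residue classes of [T] yields a packing of [F] by balls of radius [d], whose
    content is at most 1. *)
Lemma packing_number_le (R : realType) (m : nat) (F : set 'rV[R]_m) (s d0 d : R)
    (T : {fset 'rV[int]_m}) :
  0 < d <= d0 -> (packing_content s d0 F <= 1)%E ->
  (forall z, z \in T -> exists f, F f /\
     forall i, `|f 0 i - d * (z 0 i)%:~R| <= 3 * d) ->
  #|` T|%fset%:R * (2 * d) `^ s <= (9 ^ m)%:R.
Proof.
move=> /andP[d_gt0 dd0] cF TF.
have /choice[g gP] (z : 'rV[int]_m) : exists f, z \in T ->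
    F f /\ forall i, `|f 0 i - d * (z 0 i)%:~R| <= 3 * d.
  by case: (boolP (z \in T)) => [/TF[f]|_]; [exists f | exists 0].
(* Within a residue class mod 9 distinct lattice points are so far apart that the
   balls of radius d around their companions in F are disjoint. *)
pose cl (z : 'rV[int]_m) : {ffun 'I_m -> 'I_9} :=
  [ffun i => inord `|(z 0%R i %% 9)%Z|%N].
rewrite (card_fset_fibers cl) natr_sum mulr_suml.
apply: (@le_trans _ _ (\sum_(c : {ffun 'I_m -> 'I_9}) 1)); last first.
  by rewrite sumr_const card_ffun !card_ord.
apply: ler_sum => c _; set Tc := [fset _ in _ | _]%fset.
pose N := #|` Tc|%fset; pose z i := nth 0 (enum_fset Tc) i.
have zT i : (i < N)%N -> z i \in T /\ cl (z i) = c.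
  move=> iN; have : z i \in Tc by exact: mem_nth.
  by rewrite !inE /= => /andP[-> /eqP].
rewrite -lee_fin; apply: le_trans cF; apply: ereal_sup_ubound.
exists [set` iota 0 N], (g \o z), (fun=> d); split; last first.
  rewrite esum_fset; [|exact: finite_seq|by move=> i _; rewrite lee_fin powR_ge0].
  rewrite -fsbig_seq ?iota_uniq // sumEFin big_const_seq count_predT size_iota.
  by rewrite iter_addr_0 mulr_natl.
split.
  move=> i /=; rewrite mem_iota add0n => /andP[_].
  by move=> /zT[ziT _]; have [Fg _] := gP _ ziT; rewrite d_gt0 dd0.
move=> i j /=; rewrite !mem_iota !add0n /= => iN jN [y [yi yj]].
apply/eqP; rewrite -(nth_uniq 0 iN jN) ?fset_uniq //; apply/eqP/rowP => l.
have [ziT cli] := zT i iN; have [zjT clj] := zT j jN.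
have [_ /(_ l) gi] := gP _ ziT; have [_ /(_ l) gj] := gP _ zjT.
have := le_trans (ler_norm_enorm _ l) yi; have := le_trans (ler_norm_enorm _ l) yj.
rewrite /= !mxE => {yi yj}; rewrite -/(z i) -/(z j).
move: gi gj; rewrite !ler_norml => gi gj yi yj.
(* Centres of meeting balls are within [2 * d], and each is within [3 * d] of its lattice point.
   Congruence mod 9 then forces equality. *)
have {gi gj yi yj} : `|(z i 0 l)%:~R - (z j 0 l)%:~R : R| <= 8.
  rewrite -(ler_pM2l d_gt0) -{1}(gtr0_norm d_gt0) -normrM mulrBr ler_norml.
  lra.
rewrite -intrB -intr_norm -[8]/(8%:~R) ler_int => zij.
have : val (cl (z i) l) = val (cl (z j) l) by rewrite cli clj.
have m9 a : (`|(a %% 9)%Z|%N < 9)%N by lia.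
rewrite !ffunE /= !inordK //; move: zij.
by rewrite -/(z i) -/(z j); move: (z i 0 l) (z j 0 l) => a a'; lia.
Qed.

(** The error [3 * d] has three parts of at most [d]: passing from the closure to [F], rounding the
    starting point, and the slope error accumulated over [j] steps. *)
Lemma lattice_AP (R : realType) (n k h : nat) (F : set 'rV[R]_n.+1) (p q d : R)
    (v : 'rV[R]_n.+1) (w : 'rV[int]_n.+1) (a0 : int) :
  0 < d -> contains_line_between F p q v -> w 0 ord_max = h%:Z ->
  (forall i, i != ord_max -> `|(w 0 i)%:~R - h%:R * v 0 i| * k%:R <= 1) ->
  p <= d * a0%:~R -> d * (a0%:~R + h%:R * k%:R) <= q ->
  exists a : 'rV[int]_n.+1, a 0 ord_max = a0 /\
    forall j, (j < k)%N -> exists f, F f /\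
      forall i, `|f 0 i - d * ((a + w *+ j) 0 i)%:~R| <= 3 * d.
Proof.
move=> d0 [x [xl xF]] wh wv pa aq.
(* The point of the line at height [d * a0], rounded down to the lattice. *)
exists (\row_i if i == ord_max then a0 else
               Num.floor ((x 0 i + d * a0%:~R * v 0 i) / d)).
rewrite mxE eqxx; split=> // j jk.
pose t : R := d * (a0%:~R + h%:R * j%:R).
have h0 : 0 <= h%:R :> R by [].
have jk' : j%:R <= k%:R :> R by rewrite ler_nat ltnW.
have j0 : 0 <= j%:R :> R by [].
have tpq : p <= t <= q.
  rewrite /t mulrDr (le_trans pa) ?lerDl ?mulr_ge0 ?(ltW d0) //=.
  by rewrite (le_trans _ aq) // mulrDr lerD2l ler_pM2l // ler_wpM2l.
have [f [Ff [_ /(_ 0) fb]]] := xF t tpq _ (nbhsx_ballx _ _ d0).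
exists f; split=> // i; have := fb i.
have mulE : (w 0 i *+ j)%:~R = j%:R * (w 0 i)%:~R :> R by rewrite rmorphMn mulr_natl.
rewrite /ball /= !mxE mulmxnE intrD mulE; case: eqP => [->|/eqP il].
  rewrite xl wh add0r mulr1 => fi.
  have -> : d * (a0%:~R + j%:R * h%:R) = t by rewrite /t; ring.
  by rewrite distrC (le_trans (ltW fi)) //; lra.
move=> fi; set y := (_ / d).
have /andP[y1 y2] := floor_itv y; rewrite intrD in y2.
have yd : d * y = x 0 i + d * a0%:~R * v 0 i.
  by rewrite /y mulrC divfK // gt_eqF.
have e1 : `|(w 0 i)%:~R - h%:R * v 0 i| * j%:R <= 1.
  by apply: le_trans (wv i il); rewrite ler_wpM2l.
set W : R := (w 0 i)%:~R in e1 *; set Y : R := (Num.floor y)%:~R in y1 y2 *.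
have -> : f 0 i - d * (Y + j%:R * W) =
   - (x 0 i + t * v 0 i - f 0 i) + (d * (y - Y) - d * ((W - h%:R * v 0 i) * j%:R)).
  by rewrite mulrBr yd /t; ring.
have e2 : `|d * (y - Y)| <= d.
  by rewrite normrM gtr0_norm // ger_pMr // ler_norml; lra.
have e3 : `|d * ((W - h%:R * v 0 i) * j%:R)| <= d.
  by rewrite normrM gtr0_norm // ger_pMr // normrM (ger0_norm j0).
apply: le_trans (ler_normD _ _) _; rewrite normrN.
have := le_trans (ler_normB (d * (y - Y)) (d * ((W - h%:R * v 0 i) * j%:R))) (lerD e2 e3).
lra.
Qed.

Lemma lattice_count (R : realType) (n k : nat) (F : set 'rV[R]_n.+1)
    (s d0 p q e : R) (v0 : 'rV[R]_n.+1) :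
  (0 < k)%N -> 0 < d0 -> p < q -> 0 < e ->
  (packing_content s d0 F <= 1)%E ->
  ball v0 e `<=` closure (contains_line_between F p q) ->
  exists (r g0 : nat) (c : R), [/\ (0 < r)%N, 0 < c & forall g, (g0 <= g)%N ->
    (r * g * AP_min k (g ^ n))%:R * (c / g%:R) `^ s <= (9 ^ n.+1)%:R].
Proof.
move=> k0 d0_gt0 pq e0 cF vF.
(* With [h = r * g], a cube of [g ^ n] integer slopes divided by [h] has side [1 / r < e], so it
   fits in the ball. *)
pose r := (Num.truncn e^-1).+1.
have r0 : 0 < r%:R :> R by [].
have re : r%:R^-1 < e.
  rewrite invf_plt ?posrE //.
  by have /truncn_itv/andP[] : 0 <= e^-1 by rewrite invr_ge0 ltW.
(* The mesh [d = kap / h] makes [k.+1] steps of height [d * h] fill [[p, q]]: [k] for the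
   progression and one for the choice of starting height. *)
pose kap : R := (q - p) / k.+1%:R.
have kap0 : 0 < kap by rewrite divr_gt0 // subr_gt0.
pose g0 := (Num.truncn (kap / d0)).+1.
exists r, g0, (2 * kap / r%:R); split=> //; first by rewrite divr_gt0 // mulr_gt0.
move=> g g0g; have g_gt0 : (0 < g)%N by apply: leq_trans g0g.
have gR : 0 < g%:R :> R by rewrite ltr0n.
pose h := (r * g)%N; have h_gt0 : (0 < h)%N by rewrite muln_gt0.
have hR : 0 < h%:R :> R by rewrite ltr0n.
pose d : R := kap / h%:R; have d_gt0 : 0 < d by rewrite divr_gt0.
have hd : d * h%:R = kap by rewrite /d divfK // gt_eqF.
have dd0 : d <= d0.
  have : kap / d0 <= g%:R.
    have /truncn_itv/andP[_ /ltW h1] : 0 <= kap / d0 by rewrite divr_ge0 // ltW.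
    by apply: (le_trans h1); rewrite ler_nat.
  rewrite ler_pdivrMr // => h1; rewrite ler_pdivrMr // (le_trans h1) // mulrC.
  by rewrite ler_pM2l // ler_nat leq_pmull.
pose y i : R := h%:R * v0 0 i.
pose wf (f : {ffun 'I_n -> 'I_g}) : 'rV[int]_n.+1 :=
  \row_i if unlift ord_max i is Some i' then Num.floor (y i) + (f i' : nat)%:Z
         else h%:Z.
have wfl f : wf f 0 ord_max = h%:Z by rewrite mxE unlift_none.
have wfi f i' : wf f 0 (lift ord_max i') =
    Num.floor (y (lift ord_max i')) + (f i' : nat)%:Z by rewrite mxE liftK.
have wf_inj : injective wf.
  move=> f f' ff'; apply/ffunP => i.
  have : wf f 0 (lift ord_max i) = wf f' 0 (lift ord_max i) by rewrite ff'.
  by rewrite !wfi => /addrI[] /val_inj.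
pose b := Num.ceil (p / d).
have wfAP (f : {ffun 'I_n -> 'I_g}) (i : 'I_h) :
    exists a : 'rV[int]_n.+1, a 0 ord_max = b + (i : nat)%:Z /\
    forall j, (j < k)%N -> exists f', F f' /\
      forall l, `|f' 0 l - d * ((a + wf f *+ j) 0 l)%:~R| <= 3 * d.
  (* The last entry does not affect [dir u], but it must agree with [v0] for [u] to lie in the
     ball. *)
  pose u : 'rV[R]_n.+1 :=
    \row_l if l == ord_max then v0 0 ord_max else (wf f 0 l)%:~R / h%:R.
  have ue : ball v0 e u.
    split=> // i0 l; rewrite (ord1 i0) /ball /= mxE.
    case: (unliftP ord_max l) => [l'|] ->; last by rewrite eqxx subrr normr0.
    rewrite eq_sym (negPf (neq_lift _ _)) wfi.
    set l1 := lift _ _; apply: le_lt_trans re.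
    have -> : r%:R^-1 = g%:R / h%:R :> R.
      by rewrite /h natrM invfM mulrCA mulfV ?mulr1 // gt_eqF.
    have -> : v0 0 l1 = y l1 / h%:R by rewrite /y mulrC mulKf // gt_eqF.
    rewrite -mulrBl normrM (gtr0_norm (x := h%:R^-1)) ?invr_gt0 //.
    rewrite ler_pM2r ?invr_gt0 // intrD.
    have /andP[y1 y2] := floor_itv (y l1); rewrite intrD in y2.
    have f0 : 0 <= (f l')%:R :> R by [].
    have f1 : (f l')%:R + 1 <= g%:R :> R by rewrite natr1 ler_nat ltn_ord.
    have -> : (f l' : nat)%:Z%:~R = (f l')%:R :> R by [].
    rewrite ler_norml; lra.
  (* A direction [v] this close to [u] satisfies the slope condition of [lattice_AP]. *)
  have hk0 : 0 < (h%:R * k%:R)^-1 :> R by rewrite invr_gt0 mulr_gt0 // ltr0n.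
  have [v [vl [_ /(_ 0) vb]]] := vF u ue _ (nbhsx_ballx u _ hk0).
  apply: (lattice_AP d_gt0 vl (wfl f)).
  - move=> l ll; have := vb l; rewrite /ball /= mxE (negPf ll) => /ltW.
    have -> : (wf f 0 l)%:~R - h%:R * v 0 l =
        h%:R * ((wf f 0 l)%:~R / h%:R - v 0 l).
      by rewrite mulrBr mulrCA mulfV ?mulr1 // gt_eqF.
    rewrite normrM (ger0_norm (ler0n _ h)) -[leRHS]div1r ler_pdivlMr.
      by rewrite mulrC -mulrA [k%:R * _]mulrC mulrA [X in X * _]mulrC.
    by rewrite mulr_gt0 // ltr0n.
  - rewrite mulrC -ler_pdivrMr //; apply: le_trans (ceil_ge _) _.
    by rewrite -/b ler_int lerDl.
  - rewrite intrD; have /andP[b1 _] := ceil_itv (p / d).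
    have -> : (i : nat)%:Z%:~R = i%:R :> R by [].
    have i1 : i%:R + 1 <= h%:R :> R by rewrite natr1 ler_nat ltn_ord.
    have : b%:~R + i%:R + h%:R * k%:R <= p / d + h%:R * k.+1%:R :> R.
      by move: b1; rewrite intrB -/b -[k.+1%:R]natr1; lra.
    rewrite -(ler_pM2l d_gt0) => /le_trans; apply.
    rewrite mulrDr [d * (p / d)]mulrC divfK ?gt_eqF // mulrA hd /kap.
    by rewrite divfK ?pnatr_eq0 // subrKC.
pose af f i := projT1 (cid (wfAP f i)).
pose T := seq_fset tt (codom (fun c : {ffun 'I_n -> 'I_g} * 'I_h * 'I_k =>
  af c.1.1 c.1.2 + wf c.1.1 *+ c.2)).
pose D := seq_fset tt (codom wf).
have cD : #|` D|%fset = (g ^ n)%N.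
  rewrite size_seq_fset undup_id; last exact/injectiveP.
  by rewrite size_codom card_ffun !card_ord.
have DP x : x \in D -> exists f, x = wf f.
  by rewrite seq_fsetE => /codomP.
have le1 : (h * AP_min k (g ^ n) <= #|` T|%fset)%N.
  rewrite -cD; apply: (@AP_min_mul_le _ _ _ ord_max b).
    by move=> _ /DP[f ->].
  move=> _ i /DP[f ->]; exists (af f i).
  have [al _] := projT2 (cid (wfAP f i)); split=> // j jk.
  by rewrite seq_fsetE; apply/codomP; exists (f, i, Ordinal jk).
have le2 : #|` T|%fset%:R * (2 * d) `^ s <= (9 ^ n.+1)%:R.
  apply: (@packing_number_le _ _ F s d0) => //; first by rewrite d_gt0.
  move=> z; rewrite seq_fsetE => /codomP[[[f i] j] ->] /=.
  by have [_ /(_ j (ltn_ord j))] := projT2 (cid (wfAP f i)).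
apply: le_trans le2; rewrite -/h.
have -> : 2 * kap / r%:R / g%:R = 2 * d.
  by rewrite /d /h natrM invfM !mulrA.
by rewrite ler_wpM2r ?powR_ge0 // ler_nat.
Qed.

(** Half of [eps] is spent on the limit in [k], half on the limit in [N] for that fixed [k]. *)
Lemma AP_min_ge_powR (R : realType) (L : nat -> R) (eps : R) :
  (forall k : nat, (0 < k)%N ->
     (fun N : nat => ln ((AP_min k N)%:R : R) / ln (N%:R : R)) @ \oo --> L k) ->
  L @ \oo --> (1 : R) -> 0 < eps ->
  exists k N0 : nat, (0 < k)%N /\
    forall N, (N0 <= N)%N -> N%:R `^ (1 - eps) <= (AP_min k N)%:R :> R.
Proof.
move=> cL L1 eps0; have e2 : 0 < eps / 2 by rewrite divr_gt0.
move/cvgrPdist_lt/(_ _ e2) : L1 => [K _ HK].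
have k0 : (0 < K.+1)%N by [].
move/cvgrPdist_lt/(_ _ e2) : (cL _ k0) => [N1 _ HN].
exists K.+1, (maxn N1 2); split=> // N; rewrite geq_max => /andP[N1N N2].
have := HK K.+1 (leqnSn K); have := HN N N1N => /=.
rewrite !ltr_distlC => /andP[h1 _] /andP[h2 _].
have lnN : 0 < ln (N%:R : R) by rewrite ln_gt0 // ltr1n.
have {h1 h2} : 1 - eps < ln ((AP_min K.+1 N)%:R : R) / ln (N%:R : R) by lra.
rewrite ltr_pdivlMr // => h.
have A0 : 0 < (AP_min K.+1 N)%:R :> R by rewrite ltr0n AP_min_gt0 // ltnW.
have N0 : (N == 0)%N = false by apply/negbTE; rewrite -lt0n ltnW.
by rewrite /powR pnatr_eq0 N0 -[leRHS]lnK ?posrE // ler_expR ltW.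
Qed.

(** If [s < n.+1] had null measure, one [F i] with dense directions would have content at most 1 at
    some scale; its lattice count then outgrows the constant bound as [g] increases. *)
Lemma packing_dim_ge (R : realType) (L : nat -> R) (n : nat) (B : set 'rV[R]_n.+1) :
  (forall k : nat, (0 < k)%N ->
     (fun N : nat => ln ((AP_min k N)%:R : R) / ln (N%:R : R)) @ \oo --> L k) ->
  L @ \oo --> (1 : R) ->
  unit_segment_every_direction B -> (n.+1%:R%:E <= packing_dim B)%E.
Proof.
move=> cL L1 useg; apply: le_ereal_inf_tmp => _ [s [s0 ms] <-].
rewrite lee_fin leNgt; apply/negP => sn.
have : (packing_measure s B < 1)%E by rewrite ms lte_fin.
move=> /ereal_inf_lt[_ [F [BF ->]] sF].
have [i [p [q [v0 [e [pq e0 vF]]]]]] := dense_directions useg BF.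
have : (packing_premeasure s (F i) < 1)%E.
  apply: le_lt_trans sF.
  apply: le_trans (nneseries_lim_ge i.+1 _); last first.
    by move=> *; exact: packing_premeasure_ge0.
  rewrite big_nat_recr //= leeDr // sume_ge0 // => *.
  exact: packing_premeasure_ge0.
move=> /ereal_inf_lt[_ [d0 /= d0_gt0 <-] /ltW cF] {sF}.
pose eta := n.+1%:R - s; have eta0 : 0 < eta by rewrite subr_gt0.
(* The loss [n * eps] in the exponent is then at most [eta / 2], leaving a net power of at least
   [eta / 2]. *)
pose eps := eta / 2 / n.+1%:R.
have eps0 : 0 < eps by rewrite !divr_gt0.
have [k [N0 [k0 HN]]] := AP_min_ge_powR cL L1 eps0.
have [r [g0 [c [r0 c0 Hg]]]] := lattice_count k0 d0_gt0 pq e0 cF vF.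
pose C := r%:R * c `^ s; have C0 : 0 < C by rewrite mulr_gt0 ?powR_gt0 // ltr0n.
pose X := (9 ^ n.+1)%:R / C.
have X0 : 0 <= X by rewrite divr_ge0 // ltW.
pose g := (maxn (maxn N0 g0) (Num.truncn ((X + 1) `^ (2 / eta)))).+1.
have gN0 : (N0 <= g)%N by rewrite /g; lia.
have gg0 : (g0 <= g)%N by rewrite /g; lia.
have g1 : 1 <= g%:R :> R by rewrite ler1n.
have gR : 0 < g%:R :> R by [].
have gX : X + 1 <= g%:R `^ (eta / 2).
  have -> : X + 1 = ((X + 1) `^ (2 / eta)) `^ (eta / 2).
    rewrite -powRrM mulrA divfK ?gt_eqF // divff // powRr1 //; lra.
  rewrite ge0_ler_powR ?nnegrE ?powR_ge0 ?divr_ge0 ?(ltW eta0) //.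
  have /truncn_itv/andP[_ /ltW h] := powR_ge0 (X + 1) (2 / eta).
  by apply: (le_trans h); rewrite ler_nat /g ltnS leq_maxr.
have AP : g%:R `^ (n%:R * (1 - eps)) <= (AP_min k (g ^ n))%:R :> R.
  rewrite powRrM powR_mulrn ?(ltW gR) // -natrX.
  (* For [n = 0] the count [g ^ n] is 1 and may be below [N0], but positivity of [AP_min]
     suffices. *)
  case: (posnP n) => [->|n0]; first by rewrite expn0 powR1 ler1n AP_min_gt0.
  apply: HN; apply: (leq_trans gN0).
  by rewrite -[X in (X <= _)%N]expn1 leq_pexp2l.
have := Hg g gg0; apply/negP; rewrite -ltNge.
apply: (@lt_le_trans _ _ (C * g%:R `^ (eta / 2))).
  by rewrite -ltr_pdivrMl // mulrC -/X; lra.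
rewrite !natrM powRM ?(ltW c0) ?invr_ge0 ?(ltW gR) //.
rewrite -powR_inv1 ?(ltW gR) // -powRrM mulN1r.
have -> : r%:R * g%:R * (AP_min k (g ^ n))%:R * (c `^ s * g%:R `^ (- s)) =
   C * (g%:R * (AP_min k (g ^ n))%:R * g%:R `^ (- s)) by rewrite /C; ring.
rewrite ler_pM2l //.
apply: (@le_trans _ _ (g%:R `^ 1 * g%:R `^ (n%:R * (1 - eps)) * g%:R `^ (- s))).
  have gne : g%:R != 0 :> R by rewrite gt_eqF.
  rewrite -!powRD ?gne ?implybT //; apply: ler_powR => //.
  have : n%:R * eps <= eta / 2.
    rewrite /eps mulrCA ger_pMr ?divr_gt0 // ler_pdivrMr // mul1r ler_nat.
    exact: leqnSn.
  rewrite /eta -natr1; lra.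
by rewrite powRr1 ?(ltW gR) // ler_wpM2r ?powR_ge0 // ler_pM2l.
Qed.

Theorem mainTheorem1 (R : realType)
  (arithmetic_kakeya : exists L : nat -> R,
     (forall k : nat, (0 < k)%N ->
        (fun N : nat => ln ((AP_min k N)%:R : R) / ln (N%:R : R)) @ \oo --> L k)
     /\ L @ \oo --> (1 : R)) :
  forall n : nat, (0 < n)%N ->
  forall B : set 'rV[R]_n,
    unit_segment_every_direction B -> packing_dim B = (n%:R)%:E.
Proof.
have [L [cL L1]] := arithmetic_kakeya.
case=> // n _ B useg; apply/eqP.
by rewrite eq_le packing_dim_le (packing_dim_ge cL L1 useg).
Qed.
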